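(* The Viterbi program with invariant $I$ is confluent modulo $\approx$.
   Context: Constraint Handling Rules (CHR) setting. A CHR state is (an equivalence class, up to renaming of variables and consistent renaming of indices, of) a pair $\langle S,T\rangle$ where $S$ is a finite indexed set of constraints $i{:}c$ and $T$ is a propagation history: a set of application records $r@i_1\ldots i_n$ for propagation rules, each index referring to a constraint in $S$. A derivation step applies an application instance of a rule $r\colon H_1 \,\backslash\, H_2 \texttt{<=>} g \mid C$ (propagation rules written $H_1 \texttt{==>} g\mid C$) to head constraints in the store, provided its guard evaluates to a proper substitution not binding head variables (error or failure in a guard means the rule does not apply) and, for propagation rules, its application record is not in $T$; it removes the $H_2$ constraints, adds the instantiated body with fresh indices, removes from $T$ records mentioning removed indices, and adds the application record for propagation rules. The Viterbi program consists of the two rules \texttt{expand @ trans(Q,Q1,PT), emit(Q,L,PE), path([L|Ls],Q,P,PathRev) ==> P1 is P*PT*PE | path(Ls,Q1,P1,[Q1|PathRev]).} \texttt{prune @ path(Ls,Q,P1,\_) $\backslash$ path(Ls,Q,P2,\_) <=> P1 >= P2 | true.} A fixed Hidden Markov Model is encoded as a fixed indexed set $\mathit{HMM}$ of ground \texttt{trans($q_1$,$q_2$,$p$)} and \texttt{emit($q$,$L$,$p$)} constraints, with at most one \texttt{trans($q_1$,$q_2$,$\ldots$)} per pair of states and at most one \texttt{emit($q$,$L$,$\ldots$)} per state and letter; $q_0$ is a fixed initial state and $Ls_0$ a fixed input emission sequence. Invariant: $I(\Sigma)$ iff $\Sigma$ is reachable by zero or more derivation steps from $\langle \mathit{HMM}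 \cup \{(0\colon \texttt{path($Ls_0$,$q_0$,1,[$q_0$])})\}, \emptyset\rangle$. Equivalence: $\approx$ is the smallest equivalence relation on $I$-states such that $\langle S\cup \mathit{HMM}, T \rangle \approx \langle S'\cup \mathit{HMM}, T\rangle$ iff for any $i\colon \texttt{path($Ls$,$q$,$P$,$qs$)} \in S$ there is an $i\colon \texttt{path($Ls$,$q$,$P$,$qs'$)} \in S'$, and vice versa (same index, remaining sequence, HMM state and probability; the path may differ). The program is confluent modulo $\approx$ (with respect to $I$) iff for all $I$-states $x,y,y'$ with $y'$ and $y$ both reachable from $x$ by derivations, there exist $z,z'$ with $y'$ deriving $z'$, $y$ deriving $z$, and $z'\approx z$. *)

(* Defs.v *)
(* MathComp + finmap. *)
From Stdlib Require Import Ascii String Relation_Operators.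
From HB Require Import structures.
From mathcomp Require Import all_boot all_order all_algebra.
From mathcomp Require Import finmap.

Set Implicit Arguments.
Unset Strict Implicit.
Unset Printing Implicit Defensive.

Import Order.TTheory GRing.Theory Num.Theory.
Local Open Scope ring_scope.
Local Open Scope fset_scope.
Local Open Scope fmap_scope.

HB.instance Definition _ :=
  Countable.copy ascii (can_type ascii_nat_embedding).
HB.instance Definition _ :=
  Countable.copy string (can_type string_of_list_ascii_of_string).

(** * Terms, constraints, substitutions *)

(* Prolog terms with exact arithmetic over R; constants are [Fun c [::]]. *)
Inductive term (R : Type) : Type :=
| Var of string
| Num of R
| Fun of string & seq (term R).
Arguments Var {R} _.
Arguments Num {R} _.
Arguments Fun {R} _ _.

Inductive constr (R : Type) : Type := Constr of string & seq (term R).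
Arguments Constr {R} _ _.

Fixpoint tvars (R : Type) (t : term R) : seq string :=
  match t with
  | Var x => [:: x]
  | Num _ => [::]
  | Fun _ ts => flatten (map (@tvars R) ts)
  end.

Definition cvars (R : Type) (c : constr R) : seq string :=
  let: Constr _ ts := c in flatten (map (@tvars R) ts).

Definition ground (R : Type) (t : term R) : Prop := tvars t = [::].

Fixpoint tsubst (R : Type) (s : string -> term R) (t : term R) : term R :=
  match t with
  | Var x => s x
  | Num a => Num a
  | Fun f ts => Fun f (map (tsubst s) ts)
  end.

Definition csubst (R : Type) (s : string -> term R) (c : constr R) : constr R :=
  let: Constr p ts := c in Constr p (map (tsubst s) ts).

(* First s1, then s2. *)
Definition scomp (R : Type) (s1 s2 : string -> term R) : string -> term R :=
  fun x => tsubst s2 (s1 x).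

(** * Guards *)

Inductive builtin (R : Type) : Type :=
| Is of term R & term R
| Ge of term R & term R.

Definition bsubst (R : Type) (s : string -> term R) (b : builtin R) :
    builtin R :=
  match b with
  | Is t e => Is (tsubst s t) (tsubst s e)
  | Ge e1 e2 => Ge (tsubst s e1) (tsubst s e2)
  end.

Definition bvars (R : Type) (b : builtin R) : seq string :=
  match b with
  | Is t e => tvars t ++ tvars e
  | Ge e1 e2 => tvars e1 ++ tvars e2
  end.

Inductive outcome (R : Type) : Type :=
| Error
| Failure
| Proper of string -> term R.
Arguments Error {R}.
Arguments Failure {R}.

(* [None] is an evaluation error: an unbound variable or a term which is not
   an arithmetic expression. Multiplication is the only operator needed. *)
Fixpoint aeval (R : realFieldType) (t : term R) : option R :=
  match t with
  | Num a => Some a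
  | Fun f [:: t1; t2] =>
      if f == "*"%string then
        match aeval t1, aeval t2 with
        | Some a, Some b => Some (a * b)
        | _, _ => None
        end
      else None
  | _ => None
  end.

Definition bind1 (R : Type) (x : string) (t : term R) : string -> term R :=
  fun y => if y == x then t else Var y.

Definition beval (R : realFieldType) (b : builtin R) : outcome R :=
  match b with
  | Is t e =>
      match aeval e with
      | None => Error
      | Some a =>
          match t with
          | Var x => Proper (bind1 x (Num a))
          | Num a' => if a' == a then Proper Var else Failure
          | Fun _ _ => Failure
          end
      end
  | Ge e1 e2 =>
      match aeval e1, aeval e2 with
      | Some a1, Some a2 => if a2 <= a1 then Proper Var else Failure
      | _, _ => Error
      end
  end.

(* Left-to-right evaluation of a conjunction; s accumulates the bindings. *)
Fixpoint geval_from (R : realFieldType) (s : string -> term R)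
    (g : seq (builtin R)) : outcome R :=
  match g with
  | [::] => Proper s
  | b :: g' =>
      match beval (bsubst s b) with
      | Proper s' => geval_from (scomp s s') g'
      | o => o
      end
  end.

Definition geval (R : realFieldType) (g : seq (builtin R)) : outcome R :=
  geval_from Var g.

(** * Rules, states, derivations *)

(* [kept \ removed <=> guard | body]; a propagation rule
   [kept ==> guard | body] is one with [removed = [::]]. The body [true] is
   [[::]]. *)
Record rule (R : Type) : Type := Rule {
  rname : string;
  kept : seq (constr R);
  removed : seq (constr R);
  guard : seq (builtin R);
  body : seq (constr R)
}.

Definition heads (R : Type) (r : rule R) : seq (constr R) := kept r ++ removed r.

Definition propagation (R : Type) (r : rule R) : bool := nilp (removed r).

Definition head_vars (R : Type) (r : rule R) : seq string :=
  flatten (map (@cvars R) (heads r)).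

Definition local_vars (R : Type) (r : rule R) : seq string :=
  [seq x <- flatten (map (@bvars R) (guard r)) ++
            flatten (map (@cvars R) (body r)) | x \notin head_vars r].

Definition store (R : Type) : Type := {fmap nat -> constr R}.

(* The application record r@i_1...i_n is the pair of r and i_1...i_n. *)
Definition history : Type := {fset (string * seq nat)}.

(* Representatives of states, before identification of variants. *)
Definition rstate (R : Type) : Type := (store R * history)%type.

(* A renaming of a finite set of variables or indices extends to a bijection,
   so it is enough to consider bijective renamings. *)
Definition variant (R : Type) (x y : rstate R) : Prop :=
  exists (f : string -> string) (rho : nat -> nat),
    [/\ bijective f, bijective rho,
        forall i, y.1.[? rho i] = omap (csubst (fun v => Var (f v))) x.1.[? i] &
        y.2 = [fset (a.1, map rho a.2) | a in x.2]].

(* States are equivalence classes of representatives, viewed as predicates. *)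
Definition state (R : Type) : Type := rstate R -> Prop.

Definition class_of (R : Type) (x : rstate R) : state R := variant x.

(* The substitution s matches the heads against the constraints with indices
   ks (kept) and rs (removed), and renames the variables local to the rule
   apart from the store. *)
Definition instance (R : Type) (r : rule R) (S : store R) (ks rs : seq nat)
    (s : string -> term R) : Prop :=
  [/\ uniq (ks ++ rs),
      [seq S.[? i] | i <- ks] = [seq Some (csubst s c) | c <- kept r],
      [seq S.[? i] | i <- rs] = [seq Some (csubst s c) | c <- removed r],
      {in local_vars r, forall x, exists2 y, s x = Var y &
         forall i c, S.[? i] = Some c -> y \notin cvars c} &
      {in local_vars r &, injective s}].

Definition add_constraints (R : Type) (S : store R) (ns : seq nat)
    (cs : seq (constr R)) : store R :=
  foldl (fun S' p => S'.[p.1 <- p.2]) S (zip ns cs).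

Definition rstep (R : realFieldType) (prog : seq (rule R)) (x y : rstate R) :
    Prop :=
  let S := x.1 in
  let T := x.2 in
  exists r ks rs s t ns,
    [/\ List.In r prog,
        instance r S ks rs s,
        geval (map (bsubst s) (guard r)) = Proper t,
        {in flatten [seq cvars (csubst s c) | c <- heads r],
           forall v, t v = Var v} &
      [/\ propagation r -> (rname r, ks) \notin T,
          uniq ns, size ns = size (body r),
          {in ns, forall i, i \notin domf S} &
          y = (add_constraints S.[\ [fset i in rs]] ns
                 (map (csubst (scomp s t)) (body r)),
               [fset a in T | ~~ has (fun i => i \in rs) a.2] `|`
               (if propagation r then [fset (rname r, ks)] else fset0))]].

Definition step (R : realFieldType) (prog : seq (rule R)) (X Y : state R) :
    Prop :=
  exists x y, [/\ X = class_of x, Y = class_of y & rstep prog x y].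

Definition derives (R : realFieldType) (prog : seq (rule R)) :
    state R -> state R -> Prop :=
  clos_refl_trans (state R) (step prog).

Definition confluent_modulo (R : realFieldType) (prog : seq (rule R))
    (I : state R -> Prop) (eqv : state R -> state R -> Prop) : Prop :=
  forall x y y' : state R, I x -> I y -> I y' ->
    derives prog x y' -> derives prog x y ->
    exists z z', [/\ derives prog y' z', derives prog y z & eqv z' z].

(** * The Viterbi program *)

Definition pcons (R : Type) (t ts : term R) : term R := Fun "[|]" [:: t; ts].

Definition plist (R : Type) (ts : seq (term R)) : term R :=
  foldr (@pcons R) (Fun "[]" [::]) ts.

Definition mult (R : Type) (t1 t2 : term R) : term R := Fun "*" [:: t1; t2].

Definition c_trans (R : Type) (q q1 pt : term R) : constr R :=
  Constr "trans" [:: q; q1; pt].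

Definition c_emit (R : Type) (q l pe : term R) : constr R :=
  Constr "emit" [:: q; l; pe].

Definition c_path (R : Type) (ls q p qs : term R) : constr R :=
  Constr "path" [:: ls; q; p; qs].

Definition expand (R : Type) : rule R := {|
  rname := "expand";
  kept := [:: c_trans (Var "Q") (Var "Q1") (Var "PT");
              c_emit (Var "Q") (Var "L") (Var "PE");
              c_path (pcons (Var "L") (Var "Ls")) (Var "Q") (Var "P")
                (Var "PathRev")];
  removed := [::];
  guard := [:: Is (Var "P1") (mult (mult (Var "P") (Var "PT")) (Var "PE"))];
  body := [:: c_path (Var "Ls") (Var "Q1") (Var "P1")
                (pcons (Var "Q1") (Var "PathRev"))]
|}.

(* "_1" and "_2" are the two anonymous variables. *)
Definition prune (R : Type) : rule R := {|
  rname := "prune";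
  kept := [:: c_path (Var "Ls") (Var "Q") (Var "P1") (Var "_1")];
  removed := [:: c_path (Var "Ls") (Var "Q") (Var "P2") (Var "_2")];
  guard := [:: Ge (Var "P1") (Var "P2")];
  body := [::]
|}.

Definition viterbi (R : Type) : seq (rule R) := [:: expand R; prune R].

(* Index 0 is reserved for the initial path constraint. That rows of
   probabilities sum to 1 is not required. *)
Definition is_hmm (R : realFieldType) (hmm : store R) : Prop :=
  [/\ 0%N \notin domf hmm,
      forall i c, hmm.[? i] = Some c ->
        (exists q q1 p, [/\ ground q, ground q1, 0 <= p <= 1 &
                            c = c_trans q q1 (Num p)]) \/
        (exists q l p, [/\ ground q, ground l, 0 <= p <= 1 &
                           c = c_emit q l (Num p)]),
      forall i j q q1 p p', hmm.[? i] = Some (c_trans q q1 p) ->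
        hmm.[? j] = Some (c_trans q q1 p') -> i = j &
      forall i j q l p p', hmm.[? i] = Some (c_emit q l p) ->
        hmm.[? j] = Some (c_emit q l p') -> i = j].

Definition viterbi_init (R : realFieldType) (hmm : store R) (q0 : term R)
    (ls0 : seq (term R)) : state R :=
  class_of
    (hmm.[0%N <- c_path (plist ls0) q0 (Num 1) (plist [:: q0])], fset0).

Definition viterbi_inv (R : realFieldType) (hmm : store R) (q0 : term R)
    (ls0 : seq (term R)) (X : state R) : Prop :=
  derives (viterbi R) (viterbi_init hmm q0 ls0) X.

Definition path_sub (R : Type) (S S' : store R) : Prop :=
  forall i ls q p qs, S.[? i] = Some (c_path ls q p qs) ->
    exists qs', S'.[? i] = Some (c_path ls q p qs').

Definition viterbi_eqv_gen (R : realFieldType) (hmm : store R) (q0 : term R)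
    (ls0 : seq (term R)) (X Y : state R) : Prop :=
  [/\ viterbi_inv hmm q0 ls0 X, viterbi_inv hmm q0 ls0 Y &
   exists S S' T,
     [/\ [disjoint domf S & domf hmm], [disjoint domf S' & domf hmm],
         X = class_of (S + hmm, T), Y = class_of (S' + hmm, T) &
         path_sub S S' /\ path_sub S' S]].

(* [clos_refl_sym_trans] is also reflexive outside the invariant, where it
   relates nothing else. *)
Definition viterbi_eqv (R : realFieldType) (hmm : store R) (q0 : term R)
    (ls0 : seq (term R)) : state R -> state R -> Prop :=
  clos_refl_sym_trans (state R) (viterbi_eqv_gen hmm q0 ls0).

(* Main.v *)
(* The program terminates, so two states reachable from the initial one can be
   compared through normal forms. In every reachable state, each path constraint
   carries the probability of an actual path through the model, and each such
   path consuming a prefix of the input is dominated by a path constraint as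
   soon as all expansions have been performed: pruning always leaves a witness
   that is at least as probable, and multiplication by nonnegative probabilities
   is monotone. A normal form holds exactly one path constraint for each
   reachable pair of a remaining input and a model state, which therefore carries
   the Viterbi optimum, and its history records all its possible expansions. Two
   normal forms thus agree, up to the choice of indices and of the optimal
   path. *)

From Stdlib Require Import String Relation_Operators.
From Stdlib Require Import Classical FunctionalExtensionality PropExtensionality.
From mathcomp Require Import all_boot all_order all_algebra.
From mathcomp Require Import finmap.
Require Import Defs.

Set Implicit Arguments.
Unset Strict Implicit.
Unset Printing Implicit Defensive.

Import Order.TTheory GRing.Theory Num.Theory.
Local Open Scope ring_scope.
Local Open Scope fset_scope.
Local Open Scope fmap_scope.

(** * Substitutions and ground terms *)

Section Terms.
Variable R : Type.
Implicit Types (t : term R) (c : constr R) (s : string -> term R).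

(** Arguments are nested in a list, so the hypothesis for [Fun] ranges over its members; [List.In]
    is used because [R] carries no decidable equality here. *)
Lemma term_nested_ind (P : term R -> Prop) :
    (forall x, P (Var x)) -> (forall a, P (Num a)) ->
    (forall f ts, (forall t, List.In t ts -> P t) -> P (Fun f ts)) ->
  forall t, P t.
Proof.
move=> PV PN PF; fix IH 1 => -[x|a|f ts]; [exact: PV | exact: PN | apply: PF].
elim: ts => [t []|u ts IHts t [<-|tts]]; [exact: IH | exact: IHts].
Qed.

Lemma map_In_eq (A B : Type) (f g : A -> B) (r : seq A) :
  (forall a, List.In a r -> f a = g a) -> map f r = map g r.
Proof.
elim: r => //= a r IH fg; rewrite fg ?IH //; last by left.
by move=> b rb; apply: fg; right.
Qed.

Lemma mem_flatten_In (A : Type) (B : eqType) (f : A -> seq B) r a b :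
  List.In a r -> b \in f a -> b \in flatten (map f r).
Proof.
elim: r => //= a' r IH [->|ra] fb; rewrite mem_cat; first by rewrite fb.
by rewrite IH ?orbT.
Qed.

Lemma tsubst_id s t : {in tvars t, forall v, s v = Var v} -> tsubst s t = t.
Proof.
elim/term_nested_ind: t => [x|a|f ts IH] /= sV //; first by rewrite sV ?inE.
congr Fun; rewrite -[RHS]map_id; apply: map_In_eq => t tst; apply: IH => // v vt.
by apply: sV; apply: mem_flatten_In vt.
Qed.

Lemma tsubst_comp s1 s2 t : tsubst s2 (tsubst s1 t) = tsubst (scomp s1 s2) t.
Proof.
elim/term_nested_ind: t => [x|a|f ts IH] //=.
by congr Fun; rewrite -map_comp; apply: map_In_eq.
Qed.

Lemma tsubst_ground s t : ground t -> tsubst s t = t.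
Proof. by move=> gt; apply: tsubst_id; rewrite gt. Qed.

Lemma csubst_id s c : {in cvars c, forall v, s v = Var v} -> csubst s c = c.
Proof.
case: c => p ts /= sV; have: tsubst s (Fun p ts) = Fun p ts by apply: tsubst_id.
by move=> [->].
Qed.

Lemma csubst_comp s1 s2 c : csubst s2 (csubst s1 c) = csubst (scomp s1 s2) c.
Proof.
case: c => p ts /=; congr Constr; rewrite -map_comp.
by apply: map_In_eq => t _; apply: tsubst_comp.
Qed.

Lemma ground_plist (ls : seq (term R)) :
  ground (plist ls) <-> (forall l, List.In l ls -> ground l).
Proof.
rewrite /ground; elim: ls => [|l ls IH] //=; rewrite cats0; split.
  move=> /nilP; rewrite cat_nilp => /andP[/nilP gl /nilP /IH gls] l' [<-|] //.
  exact: gls.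
by move=> g; rewrite g ?(proj2 IH) //; [move=> l' ?; apply: g; right | left].
Qed.

Lemma ground_pcons t1 t2 : ground (pcons t1 t2) <-> ground t1 /\ ground t2.
Proof.
rewrite /ground /= cats0; split=> [/nilP|[-> ->]//].
by rewrite cat_nilp => /andP[/nilP-> /nilP->].
Qed.

Lemma plist_inj : injective (@plist R).
Proof. by elim=> [|l ls IH] [|l' ls'] //= [-> /IH->]. Qed.

End Terms.

(** * Variants, classes and renamings of indices *)

Section Variants.
Variable R : Type.
Implicit Types (x y z : rstate R).

Lemma variant_refl x : variant x x.
Proof.
exists id, id; split; try by exists id.
  move=> i; case: (x.1.[? i]) => //= c; rewrite csubst_id //.
apply/fsetP=> a; apply/idP/imfsetP => [xa|[b xb ->]].
  by exists a => //; rewrite map_id; case: a xa.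
by rewrite map_id; case: b xb.
Qed.

Lemma variant_sym x y : variant x y -> variant y x.
Proof.
move=> [f [rho [[f' fK f'K] [rho' rK r'K] Sxy Txy]]].
exists f', rho'; split; [by exists f | by exists rho | move=> i |].
  rewrite -{2}[i]r'K Sxy; case: (x.1.[? _]) => //= c.
  by rewrite csubst_comp csubst_id // => v _; rewrite /scomp /= fK.
apply/fsetP=> a; apply/idP/imfsetP => [xa|[b]].
  exists (a.1, map rho a.2); last by rewrite mapK //; case: a xa.
  by rewrite Txy; apply/imfsetP; exists a.
rewrite Txy => /imfsetP[a' xa' ->] -> /=; rewrite mapK //.
by case: a' xa'.
Qed.

Lemma variant_trans x y z : variant x y -> variant y z -> variant x z.
Proof.
move=> [f [rho [bf brho Sxy Txy]]] [g [sigma [bg bsigma Syz Tyz]]].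
exists (g \o f), (sigma \o rho); split; [exact: bij_comp | exact: bij_comp | |].
  move=> i /=; rewrite Syz Sxy; case: (x.1.[? _]) => //= c.
  by rewrite csubst_comp.
rewrite Tyz Txy -imfset_comp; apply: eq_imfset => // a /=.
by rewrite map_comp.
Qed.

(** Classes are predicates, so extensionality reduces their equality to mutual inclusion, which
    symmetry and transitivity of [variant] provide. *)
Lemma class_ofP x y : class_of x = class_of y <-> variant x y.
Proof.
split=> [E|xy]; first by rewrite -/(class_of x y) E; apply: variant_refl.
apply: functional_extensionality => z; apply: propositional_extensionality.
by split; apply: variant_trans => //; apply: variant_sym.
Qed.

Lemma exists_renaming (rho rho' : nat -> nat) x :
    cancel rho rho' -> cancel rho' rho ->
  exists y, [/\ forall i, y.1.[? rho i] = x.1.[? i],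
               y.2 = [fset (a.1, map rho a.2) | a in x.2] & variant x y].
Proof.
(* The default [c0] is never read: every index in the domain of [S] is some [rho i] with [i] in the
   domain of [x.1], and [rho'] brings it back to [i]. *)
move=> rK r'K; pose c0 : constr R := Constr ""%string [::].
pose S := [fmap k : [fset rho i | i in domf x.1] => odflt c0 x.1.[? rho' (val k)]].
have SE i : S.[? rho i] = x.1.[? i].
  case: (boolP (i \in domf x.1)) => xi.
    have ri : rho i \in domf S by apply/imfsetP; exists i.
    by rewrite in_fnd ffunE /= rK in_fnd.
  rewrite !not_fnd //; apply: contra xi => /imfsetP[j /= xj].
  by move/(can_inj rK)->.
exists (S, [fset (a.1, map rho a.2) | a in x.2]); split=> //.
exists id, rho; split=> //; [by exists id | by exists rho' |].
move=> i /=; rewrite SE; case: (x.1.[? i]) => //= c.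
by rewrite csubst_id.
Qed.

End Variants.

(* Each new pair is added by composing with a transposition. *)
Lemma extend_partial_injection (P : nat -> nat -> Prop) (r : seq nat) :
    (forall k k1 k2, P k k1 -> P k k2 -> k1 = k2) ->
    (forall k1 k2 k, P k1 k -> P k2 k -> k1 = k2) ->
  exists sigma, bijective sigma /\
    (forall k k', k \in r -> P k k' -> sigma k = k').
Proof.
move=> Pfun Pinj; elim: r => [|k r [sigma [bs IH]]].
  by exists id; split=> //; exists id.
case: (classic (exists k', P k k')) => [[k' Pk]|nP]; last first.
  exists sigma; split=> // k1 k1'; rewrite inE => /predU1P[-> Pk1|].
    by case: nP; exists k1'.
  exact: IH.
pose swap a b (i : nat) := if i == a then b else if i == b then a else i.
have swapK a b : involutive (swap a b).
  move=> i; rewrite /swap; have [->|ia] := eqVneq i a.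
    by rewrite eqxx; case: eqP.
  have [->|ib] := eqVneq i b; first by rewrite eqxx.
  by rewrite (negPf ia) (negPf ib).
exists (swap (sigma k) k' \o sigma); split.
  by apply: bij_comp bs; apply: inv_bij.
move=> k1 k1' rk1 Pk1 /=; case: (eqVneq k1 k) => [E|nk].
  by rewrite E /swap eqxx; apply: (Pfun k) => //; rewrite -E.
move: rk1; rewrite inE (negPf nk) /= => rk1.
have E := IH _ _ rk1 Pk1.
(* Values fixed earlier survive the transposition: injectivity of [sigma] keeps them away from
   [sigma k], and that of [P] away from [k']. *)
rewrite /swap (inj_eq (bij_inj bs)) (negPf nk) E; case: eqP => // Ek.
by move: nk; rewrite (Pinj k1 k k') ?eqxx // -Ek.
Qed.

(** * Paths of the model and the invariant on representatives *)

Section Viterbi.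
Variables (R : realFieldType) (hmm : store R) (q0 : term R).
Variable ls0 : seq (term R).
Hypotheses (hhmm : is_hmm hmm) (hq0 : ground q0).
Hypothesis hls0 : forall l, List.In l ls0 -> ground l.
Implicit Types (S : store R) (T : history) (x y : rstate R) (h : nat -> nat).
Implicit Types (ls : seq (term R)) (q l t : term R) (p : R) (i j k n : nat).

(** Walks of the model: [q] is reached from [q0] with probability [p] while [ls] remains to be read.
    Each letter is emitted by the state being left. *)
Inductive hmm_path : seq (term R) -> term R -> R -> Prop :=
| HmmStart : hmm_path ls0 q0 1
| HmmStep l ls q q1 p pt pe i j :
    hmm_path (l :: ls) q p ->
    hmm.[? i] = Some (c_trans q q1 (Num pt)) ->
    hmm.[? j] = Some (c_emit q l (Num pe)) -> hmm_path ls q1 (p * pt * pe).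

Definition has_path S k ls q p : Prop :=
  exists qs, S.[? k] = Some (c_path (plist ls) q (Num p) qs).

(** What pruning preserves of a path constraint: it may vanish, but only in favour of one at least
    as probable. *)
Definition dominated S ls q p : Prop :=
  exists k p', p <= p' /\ has_path S k ls q p'.

(** Here [ls], [q1] and [p] belong to the constraint that the expansion creates, not to the one at
    [k]. *)
Definition expandable S i j k ls q1 p : Prop :=
  exists l q p0 pt pe,
    [/\ hmm.[? i] = Some (c_trans q q1 (Num pt)),
        hmm.[? j] = Some (c_emit q l (Num pe)),
        has_path S k (l :: ls) q p0 & p = p0 * pt * pe].

Definition expand_record h i j k : string * seq nat :=
  ("expand"%string, [:: h i; h j; k]).

(* [h] tells where a representative of the state keeps the constraints of
   [hmm], whose indices are only fixed up to renaming. *)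
Definition viterbi_rinv h x : Prop :=
  [/\ bijective h,
      forall i c, hmm.[? i] = Some c -> x.1.[? h i] = Some c,
      forall k c, x.1.[? k] = Some c ->
        (exists2 i, k = h i & hmm.[? i] = Some c) \/
        (exists ls q p qs, [/\ c = c_path (plist ls) q (Num p) qs,
                               hmm_path ls q p & ground qs]),
      forall a, a \in x.2 -> exists i j k ls q1 p,
        [/\ a = expand_record h i j k, expandable x.1 i j k ls q1 p &
            dominated x.1 ls q1 p] &
      dominated x.1 ls0 q0 1].

(** Effect of an application of [expand], freed of matching and guard evaluation. The new list of
    states is left as an arbitrary ground [qs], since the equivalence ignores it. *)
Definition expands h x y : Prop :=
  exists i j k ls q1 p n qs,
    [/\ expandable x.1 i j k ls q1 p, expand_record h i j k \notin x.2,
        n \notin domf x.1 /\ ground qs,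
        forall k', y.1.[? k'] =
          if k' == n then Some (c_path (plist ls) q1 (Num p) qs)
          else x.1.[? k'] &
        forall a, (a \in y.2) = (a \in x.2) || (a == expand_record h i j k)].

Definition prunes x y : Prop :=
  exists k1 k2 ls q p1 p2,
    [/\ k1 != k2 /\ p2 <= p1, has_path x.1 k1 ls q p1, has_path x.1 k2 ls q p2,
        forall k, y.1.[? k] = if k == k2 then None else x.1.[? k] &
        forall a, (a \in y.2) = (a \in x.2) && (k2 \notin a.2)].

Lemma hmm_constr_ground i c : hmm.[? i] = Some c -> cvars c = [::].
Proof.
case: hhmm => _ H _ _ /H [] [q [q1 [p [gq gq1 _ ->]]]] /=;
by rewrite gq gq1.
Qed.

Lemma hmm_trans i q q1 t :
  hmm.[? i] = Some (c_trans q q1 t) ->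
  exists2 p, t = Num p & [/\ ground q, ground q1 & 0 <= p].
Proof.
case: hhmm => _ H _ _ /H [] [q' [q1' [p [gq gq1 /andP[p0 _]]]]] // [-> -> ->].
by exists p.
Qed.

Lemma hmm_emit i q l t :
  hmm.[? i] = Some (c_emit q l t) ->
  exists2 p, t = Num p & [/\ ground q, ground l & 0 <= p].
Proof.
case: hhmm => _ H _ _ /H [] [q' [q1' [p [gq gq1 /andP[p0 _]]]]] // [-> -> ->].
by exists p.
Qed.

Lemma hmm_not_path i t1 t2 t3 t4 : hmm.[? i] <> Some (c_path t1 t2 t3 t4).
Proof. by case: hhmm => _ H _ _ /H [] [q' [q1' [p []]]]. Qed.

Lemma hmm_path_ground ls q p :
  hmm_path ls q p -> ground (plist ls) /\ ground q.
Proof.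
elim=> [|l {}ls {}q q1 {}p pt pe i j _ [gl gq] /hmm_trans[_ _ [_ g _]] _].
  by rewrite ground_plist.
by case/ground_pcons: gl.
Qed.

Lemma has_path_inj S k ls q p ls' q' p' :
  has_path S k ls q p -> has_path S k ls' q' p' ->
  [/\ ls = ls', q = q' & p = p'].
Proof. by move=> [qs E] [qs']; rewrite E => -[/plist_inj -> -> -> _]. Qed.

(** * Preservation of the invariant *)

Section Invariant.
Variables (h : nat -> nat) (x : rstate R).
Hypothesis xI : viterbi_rinv h x.

Lemma rinv_ground k c : x.1.[? k] = Some c -> cvars c = [::].
Proof.
case: xI => _ _ H _ _ /H [[i _ /hmm_constr_ground]//|].
move=> [ls [q [p [qs [-> /hmm_path_ground[gls gq] gqs]]]]] /=.
by rewrite gls gq gqs.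
Qed.

Lemma rinv_path k t1 q t2 qs : x.1.[? k] = Some (c_path t1 q t2 qs) ->
  exists ls p, [/\ t1 = plist ls, t2 = Num p, hmm_path ls q p & ground qs].
Proof.
case: xI => _ _ H _ _ /H [[i _ /hmm_not_path]//|].
by move=> [ls [q' [p [qs' [[-> -> -> ->] ? ?]]]]]; exists ls, p.
Qed.

Lemma rinv_has_path k ls q p : has_path x.1 k ls q p -> hmm_path ls q p.
Proof. by move=> [qs /rinv_path[ls' [p' [/plist_inj -> [->]]]]]. Qed.

Lemma rinv_trans k q q1 t : x.1.[? k] = Some (c_trans q q1 t) ->
  exists2 i, k = h i & hmm.[? i] = Some (c_trans q q1 t).
Proof.
by case: xI => _ _ H _ _ /H [//|[ls [q' [p [qs' [//]]]]]].
Qed.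

Lemma rinv_emit k q l t : x.1.[? k] = Some (c_emit q l t) ->
  exists2 i, k = h i & hmm.[? i] = Some (c_emit q l t).
Proof.
by case: xI => _ _ H _ _ /H [//|[ls [q' [p [qs' [//]]]]]].
Qed.

Lemma rinv_path_hmm k ls q p i :
  has_path x.1 k ls q p -> i \in domf hmm -> k != h i.
Proof.
case: xI => _ H _ _ _ [qs xk]; rewrite -fndSome.
case hi: (hmm.[? i]) => [c|] // _; apply/eqP => E.
by move: xk (hi); rewrite E (H _ _ hi) => -[->] /hmm_not_path.
Qed.

Lemma expandable_fun i j k ls q1 p ls' q1' p' :
  expandable x.1 i j k ls q1 p -> expandable x.1 i j k ls' q1' p' ->
  [/\ ls = ls', q1 = q1' & p = p'].
Proof.
move=> [l [q [r [pt [pe [hi hj xk ->]]]]]].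
move=> [l' [q' [r' [pt' [pe' [hi' hj' xk' ->]]]]]].
have [[_ ->] _ ->] := has_path_inj xk xk'.
by move: hi' hj'; rewrite hi hj => -[_ -> ->] [_ _ ->].
Qed.

(** The store only grows, so expandability and domination persist; the new record is dominated by
    the very constraint just added. *)
Lemma expands_rinv y : expands h x y -> viterbi_rinv h y.
Proof.
move=> [i [j [k [ls [q1 [p [n [qs [xE _ [xn gqs] yS yT]]]]]]]]].
have mono k' c : x.1.[? k'] = Some c -> y.1.[? k'] = Some c.
  move=> xk'; rewrite yS; case: eqP => // E.
  by move: xk'; rewrite E not_fnd.
have monop k' ls' q' p' : has_path x.1 k' ls' q' p' -> has_path y.1 k' ls' q' p'.
  by move=> [qs' /mono]; exists qs'.
have monod ls' q' p' : dominated x.1 ls' q' p' -> dominated y.1 ls' q' p'.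
  by move=> [k' [r [? /monop]]]; exists k', r.
have monoe i' j' k' ls' q' p' :
    expandable x.1 i' j' k' ls' q' p' -> expandable y.1 i' j' k' ls' q' p'.
  move=> [l [q [r [pt [pe [hi hj /monop xk ->]]]]]].
  by exists l, q, r, pt, pe.
case: xI => hb Hh HS HT H0; split=> //; last exact: monod.
- by move=> i' c /Hh /mono.
- move=> k' c; rewrite yS; case: eqP => [_ [<-]|_ /HS//].
  right; exists ls, q1, p, qs; split=> //.
  move: xE => [l [q [r [pt [pe [hi hj /rinv_has_path xk ->]]]]]].
  exact: HmmStep hi hj.
- move=> a; rewrite yT => /orP[/HT|/eqP->].
    move=> [i' [j' [k' [ls' [q1' [p' [-> /monoe ? /monod ?]]]]]]].
    by exists i', j', k', ls', q1', p'.
  exists i, j, k, ls, q1, p; split=> //; first exact: monoe.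
  by exists n, p; split=> //; exists qs; rewrite yS eqxx.
Qed.

(** A domination witnessed by the removed constraint passes to the kept one. Records mentioning the
    removed index are deleted, so each surviving record still has its path constraint. *)
Lemma prunes_rinv y : prunes x y -> viterbi_rinv h y.
Proof.
move=> [k1 [k2 [ls [q [p1 [p2 [[k12 p12] xk1 xk2 yS yT]]]]]]].
have mono k ls' q' p' :
    k != k2 -> has_path x.1 k ls' q' p' -> has_path y.1 k ls' q' p'.
  by move=> /negPf kk2 [qs xk]; exists qs; rewrite yS kk2.
have monod ls' q' p' : dominated x.1 ls' q' p' -> dominated y.1 ls' q' p'.
  move=> [k [r [pr xk]]]; have [E|/mono kk2] := eqVneq k k2; last first.
    by exists k, r; split=> //; apply: kk2.
  rewrite E in xk; have [<- <- Er] := has_path_inj xk2 xk.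
  exists k1, p1; split; last exact: mono.
  by apply: le_trans pr _; rewrite -Er.
have k2h i c : hmm.[? i] = Some c -> h i == k2 = false.
  move=> hi; apply/negbTE; rewrite eq_sym; apply: rinv_path_hmm xk2 _.
  by rewrite -fndSome hi.
case: xI => hb Hh HS HT H0; split=> //; last exact: monod.
- by move=> i c hi; rewrite yS (k2h i c hi) (Hh i c hi).
- by move=> k c; rewrite yS; case: eqP => // _ /HS.
- move=> a; rewrite yT => /andP[/HT + k2a].
  move=> [i [j [k [ls' [q1 [p [E xE /monod ?]]]]]]].
  exists i, j, k, ls', q1, p; split=> //.
  move: xE => [l [q' [r [pt [pe [hi hj xk ->]]]]]].
  exists l, q', r, pt, pe; split=> //; apply: mono => //.
  by move: k2a; rewrite E eq_sym /= !inE !negb_or => /and3P[].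
Qed.

End Invariant.

(** The store is ground, so renaming variables changes nothing, and renaming indices is absorbed by
    composing with [h]. *)
Lemma rinv_variant h x y : viterbi_rinv h x -> variant x y ->
  exists h', viterbi_rinv h' y.
Proof.
move=> xI [f [rho [_ brho Sxy Txy]]]; exists (rho \o h).
have {}Sxy k : y.1.[? rho k] = x.1.[? k].
  rewrite Sxy; case E: (x.1.[? k]) => [c|] //=.
  by rewrite csubst_id // (rinv_ground xI E).
have monop k ls q p : has_path x.1 k ls q p -> has_path y.1 (rho k) ls q p.
  by move=> [qs xk]; exists qs; rewrite Sxy.
have monod ls q p : dominated x.1 ls q p -> dominated y.1 ls q p.
  by move=> [k [r [? /monop]]]; exists (rho k), r.
case: xI => hb Hh HS HT H0; split; [exact: bij_comp | | | |exact: monod].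
- by move=> i c /Hh; rewrite -Sxy.
- case: (brho) => rho' _ rK k c; rewrite -[k]rK Sxy => /HS.
  case=> [[i -> hi]|]; last by right.
  by left; exists i.
- move=> a; rewrite Txy => /imfsetP[b /HT].
  move=> [i [j [k [ls [q1 [p [-> xE /monod ?]]]]]]] ->.
  exists i, j, (rho k), ls, q1, p; split=> //.
  move: xE => [l [q' [r [pt [pe [hi hj /monop xk ->]]]]]].
  by exists l, q', r, pt, pe.
Qed.

(** * Rule applications under the invariant *)

Lemma local_vars_expand : local_vars (expand R) = [:: "P1"%string; "P1"%string].
Proof. by []. Qed.

Lemma fnd_rem0 S k : S.[\ [fset i in [::]]].[? k] = S.[? k].
Proof. by rewrite fnd_restrict !inE /=; case: fndP. Qed.

Lemma fset_fresh (A : {fset nat}) : exists n, n \notin A.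
Proof.
exists (\max_(i <- enum_fset A) i).+1; apply/negP => An.
have /(_ isT) := @leq_bigmax_seq _ (enum_fset A) xpredT id _ An.
by rewrite ltnn.
Qed.

Section Steps.
Variables (h : nat -> nat) (x : rstate R).
Hypothesis xI : viterbi_rinv h x.

(** By the invariant every matched argument is ground, so the answer of the guard can only affect
    the local variable [P1]. *)
Lemma rstep_cases y :
  rstep (viterbi R) x y -> expands h x y \/ prunes x y.
Proof.
move=> [r [ks [rs [s [t [ns [rV [] ]]]]]]].
move: rV => /= [<-|[<-|[]]] {r} uniq_ks.
- case: ks uniq_ks => [|i [|j [|k []]]] //= _.
  case: rs => //= -[si sj sk] _ loc _ guardE _ [/(_ isT) Tr _ szn nS ->].
  move: ns szn nS => [|n []] //= _ /(_ n); rewrite inE eqxx => /(_ isT) nS.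
  (* [P1] is local to the rule, hence sent to a variable, so [Is] binds it instead of comparing two
     numbers. *)
  have [v sP1] : exists v, s "P1"%string = Var v.
    have [|v ->] := loc "P1"%string; last by exists v.
    by rewrite local_vars_expand inE.
  have [i' Ei hi] := rinv_trans xI si.
  have [j' Ej hj] := rinv_emit xI sj.
  have [pt Ept _] := hmm_trans hi; have [pe Epe _] := hmm_emit hj.
  have [[|l ls] [p [Els Ep xV gqs]]] := rinv_path xI sk; first by [].
  move: Els => -[El Els].
  have [/ground_pcons[gl gls] gq] := hmm_path_ground xV.
  have [_ _ [_ gq1 _]] := hmm_trans hi.
  left; exists i', j', k, ls, (s "Q1"%string), (p * pt * pe), n.
  exists (pcons (s "Q1"%string) (s "PathRev"%string)).
  move: guardE; rewrite /geval /= sP1 Ep Ept Epe /= => -[<-].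
  rewrite /expand_record -Ei -Ej; split=> //.
  + exists l, (s "Q"%string), p, pt, pe; rewrite hi hj Ept Epe El; split=> //.
    by exists (s "PathRev"%string); rewrite sk Ep Els El.
  + by split=> //; apply/ground_pcons.
  + move=> k'; rewrite /add_constraints /= fnd_set fnd_rem0; case: ifP => // _.
    rewrite /scomp sP1 Els /= /bind1 eqxx.
    by rewrite !tsubst_ground.
  + move=> a; rewrite !inE /=; congr (_ || _).
    by rewrite has_pred0 andbT.
- case: ks uniq_ks => [|k1 []] //= uniq_ks.
  case: rs uniq_ks => [|k2 []] //=; rewrite !inE andbT => k12 [s1] [s2] _ _.
  move=> guardE _ [_ _ szn _ ->]; case: ns szn => // _.
  have [ls [p1 [Els Ep1 _ _]]] := rinv_path xI s1.
  have [_ [p2 [_ Ep2 _ _]]] := rinv_path xI s2.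
  right; exists k1, k2, ls, (s "Q"%string), p1, p2.
  move: guardE; rewrite /geval /= Ep1 Ep2 /=; case: ifP => // p12 _.
  split=> //.
  + by exists (s "_1"%string); rewrite s1 Els Ep1.
  + by exists (s "_2"%string); rewrite s2 Els Ep2.
  + move=> k; rewrite /add_constraints /= fnd_restrict !inE.
    by case: eqP => //= _; case: fndP.
  + move=> a; rewrite !inE /= orbF; congr (_ && ~~ _).
    by elim: (a.2) => //= i r ->; rewrite !inE eq_sym.
Qed.

Lemma expand_enabled i j k ls q1 p :
    expandable x.1 i j k ls q1 p -> expand_record h i j k \notin x.2 ->
  exists y, rstep (viterbi R) x y.
Proof.
move=> [l [q [r [pt [pe [hi hj xk Ep]]]]]] xT.
have [_ _ [gq gq1 _]] := hmm_trans hi; have [_ _ [_ gl _]] := hmm_emit hj.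
have [hb Hh _ _ _] := xI.
have hij : h i != h j.
  by rewrite (inj_eq (bij_inj hb)); apply/eqP => E; move: hi; rewrite E hj.
have hik : h i != k.
  by rewrite eq_sym; apply: (rinv_path_hmm xI xk); rewrite -fndSome hi.
have hjk : h j != k.
  by rewrite eq_sym; apply: (rinv_path_hmm xI xk); rewrite -fndSome hj.
case: xk => qs xk; have [_ [_ [_ _ _ gqs]]] := rinv_path xI xk.
have [gls _] := hmm_path_ground (rinv_has_path xI (ex_intro _ qs xk)).
have gls' : ground (plist ls) by case/ground_pcons: gls.
(* The values are forced by matching the heads. [P1] stays itself, which is fresh because the store
   is ground. *)
pose sigma (v : string) : term R :=
  if v == "Q"%string then q else if v == "Q1"%string then q1
  else if v == "PT"%string then Num pt else if v == "PE"%string then Num pe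
  else if v == "L"%string then l else if v == "Ls"%string then plist ls
  else if v == "P"%string then Num r else if v == "PathRev"%string then qs
  else Var v.
have [n xn] := fset_fresh (domf x.1).
eexists; exists (expand R), [:: h i; h j; k], [::], sigma.
exists (scomp Var (bind1 "P1"%string (Num (r * pt * pe)))), [:: n].
split; last split=> //.
- by left.
- split=> //.
  + by rewrite /= !inE negb_or hij hik hjk.
  + by rewrite /= (Hh i _ hi) (Hh j _ hj) xk.
  + rewrite local_vars_expand => v; rewrite !inE orbb => /eqP->.
    by exists "P1"%string => // k' c /(rinv_ground xI) ->.
  + by rewrite local_vars_expand => v w; rewrite !inE !orbb => /eqP-> /eqP->.
- by [].
- move=> v /=; rewrite /sigma /= gl gq gq1 gls' gqs //.
- by move=> v; rewrite inE => /eqP->.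
Qed.

(** Probabilities are totally ordered, so of two constraints competing for the same pair one can
    always prune the other. *)
Lemma prune_enabled k1 k2 ls q p1 p2 :
    k1 != k2 -> has_path x.1 k1 ls q p1 -> has_path x.1 k2 ls q p2 ->
  exists y, rstep (viterbi R) x y.
Proof.
wlog p21 : k1 k2 p1 p2 / p2 <= p1.
  move=> W k12 xk1 xk2; case: (leP p2 p1) => [|/ltW] p12; first exact: W xk1 xk2.
  by apply: W p12 _ xk2 xk1; rewrite eq_sym.
move=> k12 [qs1 xk1] [qs2 xk2].
have [_ [_ [_ _ _ gqs1]]] := rinv_path xI xk1.
have [_ [_ [_ _ _ gqs2]]] := rinv_path xI xk2.
have [gls gq] := hmm_path_ground (rinv_has_path xI (ex_intro _ qs1 xk1)).
pose sigma (v : string) : term R :=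
  if v == "Ls"%string then plist ls else if v == "Q"%string then q
  else if v == "P1"%string then Num p1 else if v == "P2"%string then Num p2
  else if v == "_1"%string then qs1 else if v == "_2"%string then qs2
  else Var v.
eexists; exists (prune R), [:: k1], [:: k2], sigma, (scomp Var Var), [::].
split; last split=> //.
- by right; left.
- split=> //.
  + by rewrite /= !inE k12.
  + by rewrite /= xk1.
  + by rewrite /= xk2.
- by rewrite /geval /= p21.
- by move=> v /=; rewrite /sigma /= gls gq gqs1 gqs2.
Qed.

End Steps.

(** * Normal forms, where neither rule applies *)

Definition normal h x : Prop :=
  (forall k1 k2 ls q p1 p2,
     has_path x.1 k1 ls q p1 -> has_path x.1 k2 ls q p2 -> k1 = k2) /\
  (forall i j k ls q1 p,
     expandable x.1 i j k ls q1 p -> expand_record h i j k \in x.2).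

Lemma normal_or_rstep h x : viterbi_rinv h x ->
  normal h x \/ exists y, rstep (viterbi R) x y.
Proof.
move=> xI; case: (classic (exists y, rstep (viterbi R) x y)); first by right.
move=> stuck; left; split=> [k1 k2 ls q p1 p2 xk1 xk2|i j k ls q1 p xE].
  apply/eqP/negP => /negP k12; apply: stuck.
  exact: prune_enabled xI _ _ _ _ _ _ k12 xk1 xk2.
by apply/negP => /negP xT; apply: stuck; apply: expand_enabled xI _ _ _ _ _ _ xE xT.
Qed.

(** * Termination by a weight on stores *)

Section Measure.
Variable h : nat -> nat.

(** Contains every pair of a transition and an emission, so its size bounds the number of expansions
    of one path constraint. *)
Definition hmm_pairs : seq (nat * nat) :=
  [seq (i, j) | i <- enum_fset (domf hmm), j <- enum_fset (domf hmm)].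

Definition pending T k : nat :=
  count (fun ij => expand_record h ij.1 ij.2 k \notin T) hmm_pairs.

Fixpoint list_size (t : term R) : nat :=
  if t is Fun _ [:: _; t'] then (list_size t').+1 else 0.

(* Exceeds the weight of the constraint created by expanding a path constraint
   with [m] letters left. *)
Fixpoint expansion_weight (m : nat) : nat :=
  if m is m'.+1 then (size hmm_pairs * expansion_weight m').+2 else 0.

(** Each pending expansion pays in advance for the constraint it may create; the extra unit makes a
    removal decrease the total. Having four arguments tells path constraints from those of the
    model. *)
Definition weight x k : nat :=
  if x.1.[? k] is Some (Constr _ [:: t; _; _; _])
  then (pending x.2 k * expansion_weight (list_size t)).+1 else 0.

Definition total_weight x : nat := (\sum_(k <- domf x.1) weight x k)%N.

Lemma list_size_plist ls : list_size (plist ls) = size ls.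
Proof. by elim: ls => //= l ls ->. Qed.

Lemma weight_path x k ls q p : has_path x.1 k ls q p ->
  weight x k = (pending x.2 k * expansion_weight (size ls)).+1.
Proof. by move=> [qs xk]; rewrite /weight xk /= list_size_plist. Qed.

Lemma has_path_domf x k ls q p : has_path x.1 k ls q p -> k \in domf x.1.
Proof. by move=> [qs xk]; rewrite -fndSome xk. Qed.

Lemma mem_hmm_pairs i j c d :
  hmm.[? i] = Some c -> hmm.[? j] = Some d -> (i, j) \in hmm_pairs.
Proof.
move=> hi hj; apply/allpairsP; exists (i, j); split=> //=.
  by rewrite -fndSome hi.
by rewrite -fndSome hj.
Qed.

(** The expanded constraint loses a pending pair, worth more than the whole weight of the new
    constraint, and no other constraint gains weight. *)
Lemma expands_weight x y :
  viterbi_rinv h x -> expands h x y -> (total_weight y < total_weight x)%N.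
Proof.
move=> xI [i [j [k [ls [q1 [p [n [qs [xE xT [xn gqs] yS yT]]]]]]]]].
have [l [q [r [pt [pe [hi hj xk _]]]]]] := xE.
have yD : domf y.1 = n |` domf x.1.
  apply/fsetP => k'; rewrite !inE -!fndSome yS.
  by case: eqP.
have xDk := has_path_domf xk.
have nk : n != k by apply: contraNneq xn => ->.
have yk : has_path y.1 k (l :: ls) q r.
  by case: xk => qs' xk; exists qs'; rewrite yS eq_sym (negPf nk).
have yn : has_path y.1 n ls q1 p by exists qs; rewrite yS eqxx.
rewrite /total_weight yD (big_fsetU1 _ _ xn) /= !(big_fsetD1 _ xDk) addnA.
have rest : (\sum_(k' <- domf x.1 `\ k) weight y k' <=
             \sum_(k' <- domf x.1 `\ k) weight x k')%N.
  rewrite big_seq [X in (_ <= X)%N]big_seq; apply: leq_sum => k'.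
  rewrite !inE => /andP[kk' xk'].
  have nk' : k' != n by apply: contraNneq xn => <-.
  rewrite /weight yS (negPf nk').
  case: (x.1.[? k']) => [[_ [|t [|? [|? [|? []]]]]]|] //.
  rewrite ltnS leq_mul2r; apply/orP; right; apply: sub_count => ij /=.
  by rewrite yT negb_or => /andP[].
have lt_pending : (pending y.2 k < pending x.2 k)%N.
  rewrite /pending.
  (* An occurrence of [(i, j)] is isolated, as its record was absent and is now present; elsewhere
     the count cannot increase. *)
  have : (i, j) \in hmm_pairs by apply: mem_hmm_pairs hi hj.
  case/splitPr => s1 s2; rewrite !count_cat /= xT yT eqxx orbT /=.
  rewrite add0n add1n addnS ltnS.
  by apply: leq_add; apply: sub_count => ij /=; rewrite yT negb_or => /andP[].
have new : (weight y n <= (size hmm_pairs * expansion_weight (size ls)).+1)%N.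
  by rewrite (weight_path yn) ltnS leq_mul2r count_size orbT.
have old : (weight y k + expansion_weight (size (l :: ls)) <= weight x k)%N.
  rewrite (weight_path yk) (weight_path xk) addSn ltnS addnC -mulSn.
  by rewrite leq_mul2r lt_pending orbT.
rewrite -addSn; apply: leq_add rest; apply: leq_trans old.
by rewrite addnC -addnS leq_add2l /= ltnS.
Qed.

Lemma prunes_weight x y :
  viterbi_rinv h x -> prunes x y -> (total_weight y < total_weight x)%N.
Proof.
move=> xI [k1 [k2 [ls [q [p1 [p2 [_ _ xk2 yS yT]]]]]]].
have yD : domf y.1 = domf x.1 `\ k2.
  apply/fsetP => k'; rewrite !inE -!fndSome yS.
  by case: eqP.
rewrite /total_weight yD (big_fsetD1 _ (has_path_domf xk2)) /=.
rewrite (weight_path xk2) addSn ltnS; apply: leq_trans (leq_addl _ _).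
rewrite big_seq [X in (_ <= X)%N]big_seq; apply: leq_sum => k'.
rewrite !inE => /andP[kk' xk'].
rewrite /weight yS (negPf kk').
case: (x.1.[? k']) => [[_ [|t [|? [|? [|? []]]]]]|] //.
rewrite ltnS leq_mul2r; apply/orP; right; rewrite /pending.
(* Only records mentioning [k2] are deleted, and an expansion of [k'] mentions [k'] and model
   indices, all different from [k2]. *)
rewrite (eq_in_count (a2 := fun ij => expand_record h ij.1 ij.2 k' \notin x.2)) //.
move=> ij /allpairsP[[i j] /= [hi hj ->]]; rewrite yT /= !inE !negb_or.
rewrite (rinv_path_hmm xI xk2 hi) (rinv_path_hmm xI xk2 hj).
by rewrite [k2 == k']eq_sym kk' /= andbT.
Qed.

End Measure.

Lemma normalizes h x : viterbi_rinv h x ->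
  exists y, [/\ derives (viterbi R) (class_of x) (class_of y),
               viterbi_rinv h y & normal h y].
Proof.
move: {2}(total_weight h x) (leqnn (total_weight h x)) => m.
elim/ltn_ind: m x => m IH x xm xI.
case: (normal_or_rstep xI) => [xN|[y xy]].
  by exists x; split=> //; apply: rt_refl.
have [yI yx] : viterbi_rinv h y /\ (total_weight h y < total_weight h x)%N.
  case: (rstep_cases xI xy) => xy'.
    by split; [apply: expands_rinv xy' | apply: expands_weight xy'].
  by split; [apply: prunes_rinv xy' | apply: prunes_weight xy'].
have [z [yz zI zN]] := IH _ (leq_trans yx xm) y (leqnn _) yI.
exists z; split=> //; apply: rt_trans yz; apply: rt_step.
by exists x, y.
Qed.

(** * Reachable states satisfy the invariant *)

Lemma init_rinv :
  viterbi_rinv id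
    (hmm.[0%N <- c_path (plist ls0) q0 (Num 1) (plist [:: q0])], fset0).
Proof.
have [h0 _ _ _] := hhmm.
split; first by exists id.
- move=> i c hi; rewrite fnd_set; case: eqP => // E.
  by move: h0; rewrite -E -fndSome hi.
- move=> k c; rewrite fnd_set; case: eqP => [_ [<-]|_ hk]; last by left; exists k.
  right; exists ls0, q0, 1, (plist [:: q0]); split=> //; first exact: HmmStart.
  by rewrite ground_plist => l [<-|[]].
- by move=> a; rewrite inE.
- exists 0%N, 1; split=> //; exists (plist [:: q0]).
  by rewrite fnd_set eqxx.
Qed.

Lemma viterbi_inv_rinv X : viterbi_inv hmm q0 ls0 X ->
  exists h x, X = class_of x /\ viterbi_rinv h x.
Proof.
rewrite /viterbi_inv; set X0 := viterbi_init _ _ _ => X0X.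
have : exists h x, X0 = class_of x /\ viterbi_rinv h x.
  by exists id; eexists; split; last exact: init_rinv.
elim: X0X => {X0 X} [X Y [x [y [-> -> xy]]] [h [x' [/esym/class_ofP x'x x'I]]]|//|].
  (* The step may start from another representative than the one known to satisfy the invariant. *)
  have [h' xI] := rinv_variant x'I x'x.
  exists h', y; split=> //; case: (rstep_cases xI xy).
    exact: expands_rinv.
  exact: prunes_rinv.
by move=> X Y Z _ IHX _ IHY /IHX /IHY.
Qed.

(** * Agreement of two normal forms *)

Lemma normal_dominated h x ls q p : viterbi_rinv h x -> normal h x ->
  hmm_path ls q p -> dominated x.1 ls q p.
Proof.
move=> xI [_ xN]; have [hb Hh _ HT H0] := xI; elim=> // {ls q p}.
move=> l ls q q1 p pt pe i j _ [k [p' [pp' xk]]] hi hj.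
(* The constraint dominating the shorter path can be expanded; normality records this expansion, and
   the invariant then dominates its result. *)
have xE : expandable x.1 i j k ls q1 (p' * pt * pe) by exists l, q, p', pt, pe.
have [i' [j' [k' [ls' [q1' [r [E xE' [k1 [p1 [p1r xk1]]]]]]]]]] :=
  HT _ (xN _ _ _ _ _ _ xE).
case: E => /(bij_inj hb) Ei /(bij_inj hb) Ej Ek; rewrite -Ei -Ej -Ek in xE'.
have [Els Eq Er] := expandable_fun xE xE'.
exists k1, p1; rewrite Els Eq; split=> //; apply: le_trans p1r; rewrite -Er.
have [_ [<-] [_ _ pt0]] := hmm_trans hi; have [_ [<-] [_ _ pe0]] := hmm_emit hj.
by rewrite !ler_wpM2r.
Qed.

(** Domination is applied from [x] to [x'] and back to [x], where only one constraint exists for the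
    pair; the two inequalities close up into an equality. *)
Lemma normal_paths h x h' x' k ls q p :
    viterbi_rinv h x -> normal h x -> viterbi_rinv h' x' -> normal h' x' ->
  has_path x.1 k ls q p -> exists k', has_path x'.1 k' ls q p.
Proof.
move=> xI xN xI' xN' xk.
have [k' [p' [pp' xk']]] := normal_dominated xI' xN' (rinv_has_path xI xk).
have [k2 [p2 [p2p xk2]]] := normal_dominated xI xN (rinv_has_path xI' xk').
have E2 := proj1 xN _ _ _ _ _ _ xk2 xk; rewrite E2 in xk2; exists k'.
have [_ _ E] := has_path_inj xk xk2.
by have -> : p = p' by apply/le_anti; rewrite pp' E p2p.
Qed.

(** A partial bijection between the indices of two normal forms. Path constraints are matched by all
    their arguments but the last, the one that the equivalence ignores. *)
Definition index_match h x h' x' k k' : Prop :=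
  (exists i, [/\ i \in domf hmm, k = h i & k' = h' i]) \/
  (exists ls q p, has_path x.1 k ls q p /\ has_path x'.1 k' ls q p).

Lemma index_match_sym h x h' x' k k' :
  index_match h x h' x' k k' -> index_match h' x' h x k' k.
Proof.
case=> [[i [hi -> ->]]|[ls [q [p [xk xk']]]]]; first by left; exists i.
by right; exists ls, q, p.
Qed.

Lemma index_match_fun h x h' x' k k1 k2 :
    viterbi_rinv h x -> normal h' x' ->
  index_match h x h' x' k k1 -> index_match h x h' x' k k2 -> k1 = k2.
Proof.
move=> xI xN'; have [hb _ _ _ _] := xI.
case=> [[i [hi -> ->]]|[ls [q [p [xk xk1]]]]].
  case=> [[j [hj /(bij_inj hb)-> ->]]//|[ls [q [p [xk _]]]]].
  by have := rinv_path_hmm xI xk hi; rewrite eqxx.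
case=> [[j [hj E _]]|[ls' [q' [p' [xk' xk2]]]]].
  by have := rinv_path_hmm xI xk hj; rewrite E eqxx.
have [E1 E2 _] := has_path_inj xk xk'; rewrite -E1 -E2 in xk2.
exact: (proj1 xN') xk1 xk2.
Qed.

(** The history of a normal form holds exactly the possible expansions, and these depend only on
    what [index_match] preserves. *)
Lemma normal_records h x h' x' tau :
    viterbi_rinv h x -> normal h x -> viterbi_rinv h' x' -> normal h' x' ->
    (forall k k', index_match h x h' x' k k' -> tau k = k') ->
  x'.2 = [fset (a.1, map tau a.2) | a in x.2].
Proof.
move=> xI xN xI' xN' Htau.
have tau_h i c : hmm.[? i] = Some c -> tau (h i) = h' i.
  by move=> hi; apply: Htau; left; exists i; rewrite -fndSome hi.
have HT := let: And5 _ _ _ H _ := xI in H.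
have HT' := let: And5 _ _ _ H _ := xI' in H.
apply/fsetP => a; apply/idP/imfsetP => /= [/HT'|[b /HT + ->]].
  move=> [i [j [k' [ls [q1 [p [-> xE _]]]]]]].
  move: xE => [l [q [r [pt [pe [hi hj xk' Ep]]]]]].
  have [k xk] := normal_paths xI' xN' xI xN xk'.
  exists (expand_record h i j k).
    by apply: (proj2 xN _ _ _ ls q1 p); exists l, q, r, pt, pe.
  rewrite /expand_record /= (tau_h i _ hi) (tau_h j _ hj) (Htau k k') //.
  by right; exists (l :: ls), q, r.
move=> [i [j [k [ls [q1 [p [-> xE _]]]]]]].
move: xE => [l [q [r [pt [pe [hi hj xk Ep]]]]]].
have [k' xk'] := normal_paths xI xN xI' xN' xk.
rewrite /= (tau_h i _ hi) (tau_h j _ hj) (Htau k k'); last first.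
  by right; exists (l :: ls), q, r.
by apply: (proj2 xN' _ _ _ ls q1 p); exists l, q, r, pt, pe.
Qed.

Lemma split_hmm S : (forall i c, hmm.[? i] = Some c -> S.[? i] = Some c) ->
  S = S.[\ domf hmm] + hmm.
Proof.
move=> SH; apply/fmapP => i; rewrite fnd_cat.
case: ifP => [|hi]; last by rewrite fnd_restrict inE hi /=; case: fndP.
by rewrite -fndSome; case hi: (hmm.[? i]) => [c|] // _; apply: SH.
Qed.

Lemma normal_eqv h x h' x' :
    viterbi_rinv h x -> normal h x -> viterbi_rinv h' x' -> normal h' x' ->
    viterbi_inv hmm q0 ls0 (class_of x) -> viterbi_inv hmm q0 ls0 (class_of x') ->
  viterbi_eqv_gen hmm q0 ls0 (class_of x') (class_of x).
Proof.
move=> xI xN xI' xN' IX IX'; split=> //.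
have [[g gK g'K] Hh _ _ _] := xI; have [_ Hh' _ _ _] := xI'.
have [|k1 k2 k|tau [btau tauP]] :=
  @extend_partial_injection (index_match h' x' h x) (domf x'.1).
- by move=> k k1 k2; apply: index_match_fun.
- by move=> /index_match_sym + /index_match_sym; apply: index_match_fun.
have {}tauP k k' : index_match h' x' h x k k' -> tau k = k'.
  move=> kk'; apply: tauP => //; case: kk' => [[i [hi -> _]]|].
    move: hi; rewrite -!fndSome; case hi: (hmm.[? i]) => [c|] // _.
    by rewrite (Hh' _ _ hi).
  by move=> [ls [q [p [/has_path_domf]]]].
have [u [uS uT xu]] := exists_renaming x g'K gK.
case: (btau) => tau' tauK tau'K.
have [||u' [uS' uT' xu']] := @exists_renaming _ (g \o tau) (tau' \o h) x'.
- by move=> i /=; rewrite g'K.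
- by move=> i /=; rewrite tau'K.
have ET : u'.2 = u.2.
  rewrite uT' uT (normal_records xI' xN' xI xN tauP) -imfset_comp.
  by apply: eq_imfset => // a /=; rewrite map_comp.
have uH i c : hmm.[? i] = Some c -> u.1.[? i] = Some c.
  by move=> hi; rewrite -{1}(gK i) uS (Hh _ _ hi).
have uH' i c : hmm.[? i] = Some c -> u'.1.[? i] = Some c.
  move=> hi; rewrite -{1}(gK i) -(tauP (h' i) (h i)).
    by rewrite uS' (Hh' _ _ hi).
  by left; exists i; rewrite -fndSome hi.
have path_rest S i t1 t2 t3 t4 :
    (forall i c, hmm.[? i] = Some c -> S.[? i] = Some c) ->
  S.[\ domf hmm].[? i] = Some (c_path t1 t2 t3 t4) <->
  S.[? i] = Some (c_path t1 t2 t3 t4).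
  move=> SH; rewrite fnd_restrict inE -!fndSome.
  case hi: (hmm.[? i]) => [c|] /=; last by case: (S.[? i]).
  by rewrite (SH _ _ hi) -hi; split=> // /hmm_not_path.
exists u'.1.[\ domf hmm], u.1.[\ domf hmm], u.2; split.
- apply/fdisjointP => i; rewrite -fndSome fnd_restrict inE.
  by case: (i \in domf hmm).
- apply/fdisjointP => i; rewrite -fndSome fnd_restrict inE.
  by case: (i \in domf hmm).
- by rewrite -split_hmm // -ET -surjective_pairing; apply/class_ofP.
- by rewrite -split_hmm // -surjective_pairing; apply/class_ofP.
split=> i t1 q t2 qs.
  move/(proj1 (path_rest _ i _ _ _ _ uH')) => u'i.
  (* [tau' (h i)] is the index in [x'] of the constraint that the renaming moves to [i]. *)
  have Ei : i = g (tau (tau' (h i))) by rewrite tau'K gK.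
  have x'k : x'.1.[? tau' (h i)] = Some (c_path t1 q t2 qs) by rewrite -uS' /= -Ei.
  have [ls [p [E1 E2 _ _]]] := rinv_path xI' x'k; rewrite E1 E2 in x'k *.
  have xk' : has_path x'.1 (tau' (h i)) ls q p by exists qs.
  have [k xk] := normal_paths xI' xN' xI xN xk'.
  have Ek : tau (tau' (h i)) = k by apply: tauP; right; exists ls, q, p.
  case: xk => qs' xk; exists qs'; apply/(path_rest _ i _ _ _ _ uH).
  by rewrite Ei Ek uS.
move/(proj1 (path_rest _ i _ _ _ _ uH)) => ui.
have xk : x.1.[? h i] = Some (c_path t1 q t2 qs) by rewrite -uS gK.
have [ls [p [E1 E2 _ _]]] := rinv_path xI xk; rewrite E1 E2 in xk *.
have xk' : has_path x.1 (h i) ls q p by exists qs.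
have [k x'k] := normal_paths xI xN xI' xN' xk'.
have Ek : tau k = h i by apply: tauP; right; exists ls, q, p.
case: x'k => qs' x'k; exists qs'; apply/(path_rest _ i _ _ _ _ uH').
by rewrite -(gK i) -Ek -[g _]/((g \o tau) k) uS'.
Qed.

Lemma viterbi_confluent :
  confluent_modulo (viterbi R) (viterbi_inv hmm q0 ls0)
    (viterbi_eqv hmm q0 ls0).
Proof.
move=> X Y Y' _ YI YI' _ _.
have [h [x [EY xI]]] := viterbi_inv_rinv YI.
have [h' [x' [EY' xI']]] := viterbi_inv_rinv YI'.
have [z [xz zI zN]] := normalizes xI.
have [z' [xz' zI' zN']] := normalizes xI'.
rewrite {}EY {}EY' in YI YI' *.
exists (class_of z), (class_of z'); split=> //.
apply: rst_step; apply: normal_eqv zI zN zI' zN' _ _.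
  exact: rt_trans YI xz.
exact: rt_trans YI' xz'.
Qed.

End Viterbi.

Theorem theorem9 (R : realFieldType) (hmm : store R) (q0 : term R)
    (ls0 : seq (term R))
    (hhmm : is_hmm hmm) (hq0 : ground q0)
    (hls0 : forall l, List.In l ls0 -> ground l) :
  confluent_modulo (viterbi R) (viterbi_inv hmm q0 ls0)
    (viterbi_eqv hmm q0 ls0).
Proof. exact: viterbi_confluent. Qed.
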